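(* Let $f=(\alpha_1\alpha_2\cdots\alpha_n)$ be a normalized $n$-player rule. Let $i\neq j$ be indices in $\{1,\dots,n\}$ with $|\alpha_i-\alpha_j|=1$, and let $g$ be the rule obtained from $f$ by swapping the entries $\alpha_i$ and $\alpha_j$. Suppose $$\overline{\mathrm{Mov}}\{P\mid\mathrm{ord}_fP=i-1\}\cap\overline{\mathrm{Mov}}\{P\mid\mathrm{ord}_fP=j-1\}=\varnothing,$$ i.e. no position $R$ has both a chomp move to a position of $f$-ordinal $i-1$ and a chomp move to a position of $f$-ordinal $j-1$. Then $f\sim g$.
   Context: Positions are finite tuples $P=(a_1,\dots,a_k)$ of integers with $a_1\geqslant\dots\geqslant a_k\geqslant0$, where tuples differing only by trailing zeros are identified. $(0)$ is the empty position, $\mathcal{L}$ is the set of positions other than $(0)$, and $|P|=\sum a_i$ is the volume of $P$. A chomp move $P\to Q$ from $P=(a_1,\dots,a_k)$ chooses $1\leqslant x\leqslant k$ and an integer $a\geqslant0$, and sets $Q=(b_1,\dots,b_k)$ with $b_j=a_j$ for $j<x$ and $b_j=\min(a_j,a)$ for $j\geqslant x$, where $Q$ must be a different position from $P$. Write $\mathrm{Mov}P=\{Q:P\to Q\}$. For a set $\mathcal{S}$ of positions, $\overline{\mathrm{Mov}}\mathcal{S}=\{R: R\to Q\text{ for some }Q\in\mathcal{S}\}$. An $n$-player rule is a tuple $f=(\alpha_1\cdots\alpha_n)$ of distinct reals. It is normalized if $(\alpha_1,\dots,\alpha_n)$ is a permutation of $(0,1,\dots,n-1)$. Ordinals $\mathrm{ord}_f$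 are defined recursively on volume as follows. - $\mathrm{ord}_f(0)=0$. - For a position $Q$, set $s_f(Q)=\alpha_{\mathrm{ord}_fQ+1}$ if $\mathrm{ord}_fQ<n$ and $s_f(Q)=\alpha_1$ if $\mathrm{ord}_fQ=n$. - For $P\in\mathcal{L}$, $\mathrm{ord}_fP$ is the unique $i\in\{1,\dots,n\}$ with $\alpha_i=\max_{Q\in\mathrm{Mov}P}s_f(Q)$. Rules $f,g$ are isomorphic, $f\sim g$, if $\mathrm{ord}_fP=\mathrm{ord}_gP$ for all $P\in\mathcal{L}$. *)

(* Defs.v *)
From HB Require Import structures.
From mathcomp Require Import all_boot all_order all_algebra perm.
From mathcomp Require Import boolp classical_sets reals.

Set Implicit Arguments.
Unset Strict Implicit.
Unset Printing Implicit Defensive.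

Import Order.TTheory GRing.Theory Num.Theory.
Local Open Scope classical_set_scope.
Local Open Scope ring_scope.

(* Tuples are taken modulo trailing zeros, so a position is represented by its
   unique representative without zero entries. *)
Record position := Position {
  parts :> seq nat;
  partsP : sorted geq parts && (0 \notin parts)%N }.

HB.instance Definition _ := [isSub for parts].
HB.instance Definition _ := [Equality of position by <:].

Definition empty_position : position := @Position [::] isT.

(* Zero-based: [part P j] is the entry $a_{j+1}$, zero past the last one. *)
Definition part (P : position) (j : nat) : nat := nth 0%N P j.

Definition volume (P : position) : nat := sumn P.

(* [x] is zero-based: it stands for the one-based index $x+1$. *)
Definition move (P Q : position) : Prop :=
  P <> Q /\
  exists x a : nat, (x < size P)%N /\
    forall j, part Q j = if (j < x)%N then part P j else minn (part P j) a.

Definition Mov (P : position) : set position := [set Q | move P Q].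

Definition Mov_inv (S : set position) : set position :=
  [set R | exists2 Q, S Q & move R Q].

Record rule (R : realType) (n : nat) := Rule {
  entries :> n.-tuple R;
  entries_uniq : uniq entries }.

Definition normalized (R : realType) (n : nat) (f : rule R n) : Prop :=
  perm_eq f [seq k%:R | k <- iota 0 n].

Definition is_max (R : realType) (A : set R) (x : R) : Prop :=
  A x /\ forall y, A y -> y <= x.

Section Ordinals.
Variables (R : realType) (n : nat) (f : rule R n).

(* The value $s_f(Q)$ of a position [Q] with $\mathrm{ord}_f Q = o$. *)
Definition score (o : nat) : R :=
  if (o < n)%N then nth 0 f o else nth 0 f 0.

(* [m] bounds the recursion depth; [ord_fuel m P] does not depend on [m] as
   soon as [volume P <= m]. An
   index [i : 'I_n] of an entry stands for the one-based index $i+1$. *)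
Fixpoint ord_fuel (m : nat) (P : position) : nat :=
  if m is m'.+1 then
    if P == empty_position then 0%N
    else if [pick i : 'I_n |
               `[< is_max [set score (ord_fuel m' Q) | Q in Mov P]
                          (tnth f i) >]] is Some i
         then i.+1 else 0%N
  else 0%N.

Definition ord (P : position) : nat := ord_fuel (volume P) P.

End Ordinals.

Definition isomorphic (R : realType) (m n : nat) (f : rule R m) (g : rule R n) :
  Prop := forall P : position, P <> empty_position -> ord f P = ord g P.

Lemma swap_uniq (R : realType) (n : nat) (f : rule R n) (i j : 'I_n) :
  uniq [tuple tnth f (tperm i j k) | k < n].
Proof.
rewrite map_inj_uniq ?enum_uniq // => k l E.
by apply/(@perm_inj _ (tperm i j))/(tuple_uniqP _ (entries_uniq f)).
Qed.

Definition swap (R : realType) (n : nat) (f : rule R n) (i j : 'I_n) :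
  rule R n := Rule (swap_uniq f i j).

Lemma part_inj (P Q : position) : part P =1 part Q -> P = Q.
Proof.
move=> E; apply: val_inj => /=.
have szP (S : position) k : (k < size S)%N = (part S k != 0%N).
  case: ltnP => k_S; last by rewrite /part nth_default.
  apply/esym; apply: contraTneq (partsP S) => Sk0.
  by rewrite -[X in X \notin _]Sk0 mem_nth // andbF.
apply: (@eq_from_nth _ 0%N) => [|k _]; last exact: E.
have le (S T : position) : part S =1 part T -> (size S <= size T)%N.
  by move=> ST; rewrite leqNgt szP ST -szP ltnn.
by apply/eqP; rewrite eqn_leq !le // => k; rewrite E.
Qed.

Lemma volumeE (P : position) N :
  (size P <= N)%N -> volume P = (\sum_(j < N) part P j)%N.
Proof.
move=> PN; rewrite /volume sumnE (big_nth 0%N) big_mkord.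
rewrite (big_ord_widen_cond N predT (fun k => nth 0%N P k) PN) /=.
rewrite big_mkcond /=; apply: eq_bigr => k _.
by case: ltnP => // Pk; rewrite /part nth_default.
Qed.

Lemma move_volume (P Q : position) : move P Q -> (volume Q < volume P)%N.
Proof.
move=> [PQ [x [a [_ E]]]].
have le j : (part Q j <= part P j)%N.
  by rewrite E; case: ifP => // _; exact: geq_minl.
have [/= hP hQ] := (leq_maxl (size P) (size Q), leq_maxr (size P) (size Q)).
rewrite (volumeE hP) (volumeE hQ).
rewrite ltn_neqAle leq_sum ?andbT //.
apply/negP => /eqP S; apply: PQ; apply: part_inj => j.
case: (ltnP j (maxn (size P) (size Q))) => [jN|]; last first.
  by rewrite geq_max => /andP[jP jQ]; rewrite /part !nth_default.
have := leqif_sum (fun (k : 'I_(maxn (size P) (size Q))) (_ : true) =>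
  leqif_eq (le k)).
move=> /geq_leqif; rewrite S leqnn => /esym/forall_inP/(_ (Ordinal jN) isT).
by move=> /eqP.
Qed.

Lemma move_empty (P : position) : P <> empty_position -> move P empty_position.
Proof.
move=> P0; split=> //; exists 0%N, 0%N; split.
  by case: P P0 => [[|b s] h] P0 //; case: P0; apply: val_inj.
by move=> j /=; rewrite minn0 /part nth_nil.
Qed.

Lemma ord_fuelE (R : realType) (n : nat) (f : rule R n) m (P : position) :
  (volume P <= m)%N -> ord_fuel f m P = ord f P.
Proof.
rewrite /ord; move: {2}(volume P) (leqnn (volume P)) => v.
elim: v m P => [|v IH] m P Pv Pm.
  suff -> : P = empty_position by case: m {Pm}.
  apply: contrapT => /move_empty/move_volume.
  by rewrite ltnNge (leq_trans Pv).
have [->|/eqP P0] := eqVneq P empty_position; first by case: m {Pm}.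
have := move_volume (move_empty P0); case: m Pm => [|m] Pm.
  by rewrite ltnNge (leq_trans Pm).
case E : (volume P) => [|w] // _ /=.
case: ifP => // _.
suff -> : [set score f (ord_fuel f m Q) | Q in Mov P] =
          [set score f (ord_fuel f w Q) | Q in Mov P] by [].
apply: eq_imagel => Q /move_volume QP; congr score.
have [Qv Qm Qw] : [/\ volume Q <= v, volume Q <= m & volume Q <= w]%N.
  by split; rewrite -ltnS; rewrite ?E in QP Pv Pm *; rewrite ?(leq_trans QP).
by rewrite !IH.
Qed.

Lemma ord_empty (R : realType) (n : nat) (f : rule R n) :
  ord f empty_position = 0%N.
Proof. by []. Qed.

Lemma ordP (R : realType) (n : nat) (f : rule R n) (P : position) :
  (0 < n)%N -> P <> empty_position ->
  exists2 i : 'I_n, ord f P = i.+1 & forall k : 'I_n,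
    is_max [set score f (ord f Q) | Q in Mov P] (tnth f k) <-> k = i.
Proof.
move=> n0 P0; set A := [set _ | _ in _].
have scoreE o : exists k : 'I_n, score f o = tnth f k.
  rewrite /score; case: ltnP => h; [exists (Ordinal h)|exists (Ordinal n0)];
  by rewrite (tnth_nth 0).
have [k0 Ak0] : exists k, A (tnth f k).
  have [k E] := scoreE (ord f empty_position); exists k; rewrite -E.
  by exists empty_position => //; exact: move_empty.
have [i Ai] : exists i, is_max A (tnth f i).
  have Pk0 : `[< A (tnth f k0) >] by apply/asboolP.
  pose a k := `[< A (tnth f k) >].
  have [i /asboolP Ai imax] := @arg_maxP _ _ _ k0 a (tnth f) Pk0.
  exists i; split=> // y Ay; move: (Ay) => [Q _ E].
  have [k Ek] := scoreE (ord f Q).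
  by rewrite -E Ek; apply: imax; apply/asboolP; rewrite -Ek E.
have uni k : is_max A (tnth f k) <-> k = i.
  split=> [[Ak mk]|->//]; case: Ai => Ai mi.
  apply: (tuple_uniqP _ (entries_uniq f)); apply/eqP.
  by rewrite eq_le mi // mk.
exists i => //; rewrite -(@ord_fuelE _ _ f (volume P).+1 P) //=.
rewrite (introF eqP P0).
have -> : [set score f (ord_fuel f (volume P) Q) | Q in Mov P] = A.
  by apply: eq_imagel => Q /move_volume/ltnW QP; rewrite ord_fuelE.
case: pickP => [k /asboolP/uni -> //|/(_ i)/asboolP//].
Qed.

(* Main.v *)
Require Import Defs.
From mathcomp Require Import all_boot all_order all_algebra.
From mathcomp Require Import classical_sets reals.
From mathcomp Require Import perm zify.

Import Order.TTheory GRing.Theory Num.Theory.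
Local Open Scope classical_set_scope.
Local Open Scope ring_scope.

(** Exchanging two consecutive values of a normalized rule only affects the
    comparison of these two values with each other, so it can change the place
    of the maximum only at a position that can move to both scores.  A position
    of ordinal [n] also has score $\alpha_1$, which the hypothesis on the
    ordinals $i-1$ and $j-1$ does not mention; but the empty position, of
    ordinal [0], has that score too and is reachable from every nonempty one. *)

(** The index is chosen before the rule, so one [k] serves both [f] and its swap; [k = 0] covers the
    wrap-around at [o = n]. *)
Lemma scoreE (R : realType) (n o : nat) : (0 < n)%N ->
  exists2 k : 'I_n, k = o :> nat \/ k = 0%N :> nat &
    forall f : rule R n, score f o = tnth f k.
Proof.
move=> n0; rewrite /score; case: ltnP => h.
  by exists (Ordinal h) => [|f]; [left | rewrite (tnth_nth 0)].
by exists (Ordinal n0) => [|f]; [right | rewrite (tnth_nth 0)].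
Qed.

Lemma tnth_swap (R : realType) (n : nat) (f : rule R n) (i j k : 'I_n) :
  tnth (swap f i j) k = tnth f (tperm i j k).
Proof. by rewrite tnth_mktuple. Qed.

Lemma tnth_inj (R : realType) (n : nat) (f : rule R n) : injective (tnth f).
Proof. exact/tuple_uniqP/(entries_uniq f). Qed.

Lemma normalized_nat (R : realType) (n : nat) (f : rule R n) (k : 'I_n) :
  normalized f -> exists m : nat, tnth f k = m%:R.
Proof.
move=> /perm_mem fE; have := mem_tnth k f.
by rewrite fE => /mapP[m _ ->]; exists m.
Qed.

(** Entries are natural numbers, so none lies strictly between the two consecutive values: any third
    entry compares alike with both. *)
Lemma le_swap (R : realType) (n : nat) (f : rule R n) (i j k l : 'I_n) :
  normalized f -> `|tnth f i - tnth f j| = 1 ->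
  ~ (k = i /\ l = j) -> ~ (k = j /\ l = i) ->
  tnth f l <= tnth f k -> tnth (swap f i j) l <= tnth (swap f i j) k.
Proof.
move=> fN ij1 kl lk; rewrite !tnth_swap.
have [a aE] := normalized_nat _ _ _ i fN.
have [b bE] := normalized_nat _ _ _ j fN.
have [c cE] := normalized_nat _ _ _ k fN.
have [d dE] := normalized_nat _ _ _ l fN.
have ab : a = b.+1 \/ b = a.+1.
  move: ij1; rewrite aE bE; case: (leqP a b) => h.
    rewrite distrC -natrB // normr_nat => /eqP; rewrite pnatr_eq1 => /eqP; lia.
  rewrite -natrB 1?ltnW // normr_nat => /eqP; rewrite pnatr_eq1 => /eqP; lia.
have neq x y p q : tnth f x = p%:R -> tnth f y = q%:R -> x <> y -> p <> q.
  by move=> xE yE xy pq; apply/xy/(tnth_inj _ _ f); rewrite xE yE pq.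
case: tpermP => [li|lj|/(neq _ _ _ _ dE aE) da /(neq _ _ _ _ dE bE) db];
case: tpermP => [ki|kj|/(neq _ _ _ _ cE aE) ca /(neq _ _ _ _ cE bE) cb];
  subst=> //; try (by case: lk); try (by case: kl);
  rewrite ?aE ?bE ?cE ?dE ?ler_nat; lia.
Qed.

Lemma Mov_score (R : realType) (n : nat) (f : rule R n) (P : position)
    (k : 'I_n) : P <> empty_position ->
  [set score f (ord f Q) | Q in Mov P] (tnth f k) ->
  Mov_inv [set Q | ord f Q = k] P.
Proof.
move=> P0 [Q PQ]; have n0 : (0 < n)%N by exact: leq_trans (ltn_ord k).
have [l lE ->] := scoreE R n (ord f Q) n0 => /(tnth_inj _ _ f) <-.
case: lE => lE; [exists Q | exists empty_position] => //=.
exact: move_empty.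
Qed.

Theorem theorem4p1 (R : realType) (n : nat) (f : rule R n) (i j : 'I_n) :
  normalized f ->
  i <> j ->
  `|tnth f i - tnth f j| = 1 ->
  Mov_inv [set P | ord f P = i] `&` Mov_inv [set P | ord f P = j] = set0 ->
  isomorphic f (swap f i j).
Proof.
move=> fN ij ij1 disj P; have n0 : (0 < n)%N by exact: leq_trans (ltn_ord i).
have [v] := ubnP (volume P); elim: v P => // v IH P /ltnSE Pv P0.
have ordE Q : Mov P Q -> ord (swap f i j) Q = ord f Q.
  move=> /move_volume QP; have [->//|/eqP Q0] := eqVneq Q empty_position.
  by rewrite IH // (leq_trans QP).
have [k -> /(_ k)[_ /(_ erefl)[kP kmax]]] := ordP f n0 P0.
have [l -> lP] := ordP (swap f i j) n0 P0.
(* By uniqueness of the maximum, it suffices that [k] is also maximal for the swapped rule. *)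
congr (_.+1); congr nat_of_ord; apply/lP; split.
  case: kP => Q PQ Qk; exists Q => //; rewrite ordE //.
  (* Entries of [f] are distinct, so [m = k], and [Q] scores the entry at [k] under both rules. *)
  have [m _ mE] := scoreE R n (ord f Q) n0.
  by rewrite mE; congr tnth; apply: (tnth_inj _ _ f); rewrite -mE.
move=> _ [Q PQ <-]; rewrite ordE //.
have [m _ mE] := scoreE R n (ord f Q) n0; rewrite mE.
have mP : [set score f (ord f Q) | Q in Mov P] (tnth f m) by exists Q.
have Pij : ~ (Mov_inv [set P | ord f P = i] `&`
              Mov_inv [set P | ord f P = j]) P by rewrite disj.
(* Both [k] and [m] are scored by moves from [P], so [disj] excludes the pair being [i] and [j]. *)
apply: le_swap => //; last exact: kmax.
- by move=> [ki mj]; subst; apply: Pij; split; apply: Mov_score.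
- by move=> [kj mi]; subst; apply: Pij; split; apply: Mov_score.
Qed.
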